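(* Let $p>2$ be prime, $t\ge 1$, and $a$ an integer not divisible by $p$. Put $$A(p,t)=\frac{(p-3)p^{t-1}}{2}+\frac{p^{t-1}}{p+1}+\frac{3}{2}+\frac{(-1)^{t-1}(p-1)}{2(p+1)}.$$ Then $\#\bar{S}_2(a;p^t)=A(p,t)$ if $\left(\frac{a}{p}\right)=1$ and $\#\bar{S}_2(a;p^t)=\frac{\phi(p^t)}{2}$ if $\left(\frac{a}{p}\right)=-1$. Further, $\#\bar{D}_2(a;p^t)=A(p,t)$ if either $p\equiv 1\bmod 4$ and $\left(\frac{a}{p}\right)=1$, or $p\equiv 3\bmod 4$ and $\left(\frac{a}{p}\right)=-1$; and $\#\bar{D}_2(a;p^t)=\frac{\phi(p^t)}{2}$ if either $p\equiv 1\bmod 4$ and $\left(\frac{a}{p}\right)=-1$, or $p\equiv 3\bmod 4$ and $\left(\frac{a}{p}\right)=1$.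
   Context: For $n\ge2$ and $a$ coprime to $n$, $H_2(a;n)=\{(x,y)\in\mathbb{Z}^2: xy\equiv a \bmod n,\ 1\le x,y<n\}$, $\bar{S}_2(a;n)=\{x+y \bmod n:(x,y)\in H_2(a;n)\}$ and $\bar{D}_2(a;n)=\{x-y \bmod n:(x,y)\in H_2(a;n)\}$. $\phi$ is Euler's totient function and $\left(\frac{a}{p}\right)$ is the Legendre symbol. *)

(* Defs.v *)
From mathcomp Require Import all_boot all_order all_algebra.

Set Implicit Arguments.
Unset Strict Implicit.
Unset Printing Implicit Defensive.

Import GRing.Theory Num.Theory.
Local Open Scope ring_scope.

(* 'I_n ranges over 0 <= x < n, hence only the lower bound 1 <= x is added. *)
Definition H2 (a : int) (n : nat) : {set 'I_n * 'I_n} :=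
  [set u : 'I_n * 'I_n | [&& (1 <= u.1)%N, (1 <= u.2)%N
     & ((u.1 * u.2)%N%:Z == a %[mod n%:Z])%Z]].

(* 'Z_n is the ring of residues mod n only for n >= 2. *)
Definition S2bar (a : int) (n : nat) : {set 'Z_n} :=
  [set (u.1 : nat)%:R + (u.2 : nat)%:R | u : 'I_n * 'I_n in H2 a n].

Definition D2bar (a : int) (n : nat) : {set 'Z_n} :=
  [set (u.1 : nat)%:R - (u.2 : nat)%:R | u : 'I_n * 'I_n in H2 a n].

Definition legendre (a : int) (p : nat) : int :=
  if (p%:Z %| a)%Z then 0
  else if [exists x : 'I_p, ((x ^ 2)%N%:Z == a %[mod p%:Z])%Z] then 1
  else -1.

(* Used only with t >= 1, so that t.-1 is t - 1. *)
Definition A_count (p t : nat) : rat :=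
  (p%:R - 3%:R) * p%:R ^+ t.-1 / 2%:R + p%:R ^+ t.-1 / (p%:R + 1)
  + 3%:R / 2%:R + (-1) ^+ t.-1 * (p%:R - 1) / (2%:R * (p%:R + 1)).

(* Main.v *)
Require Import Defs.
From mathcomp Require Import all_boot all_order all_algebra.
From mathcomp Require Import ring zify.
Set Implicit Arguments.
Unset Strict Implicit.
Unset Printing Implicit Defensive.
Import GRing.Theory Num.Theory.
Local Open Scope ring_scope.

(** Let [R = Z/p^t], a finite local ring with maximal ideal [M] in which 2 is
invertible. The set of sums is the image of [x |-> x + a / x] on the units, and
the set of differences is the set of sums for [-a]. Two units [x], [y] have the
same image iff [(x - y) * (x * y - a) = 0], so the map is exactly two-to-one on
the units with [x ^+ 2 - a] invertible; these are all the units when [a] is not a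
square. When [a = b ^+ 2], scaling by [b] reduces to [a = 1]; the remaining units
are [1 + M] and [-1 + M], and on [1 + M] writing [x = w ^+ 2] turns the image
into [2] plus the squares of the elements of [M]. In [Z/p^(t+2)] these squares
correspond to all squares of [Z/p^t], which gives a two-step recursion. *)

(** * Two-to-one maps on finite sets *)

(** Each fibre of [f] in [A] is a pair [{x, s x}] of distinct elements. *)
Lemma card_two_to_one (T U : finType) (f : T -> U) (s : T -> T) (A : {set T}) :
  {in A, forall x, s x \in A} -> {in A, forall x, s x != x} ->
  {in A &, forall x y, (f x == f y) = (y == x) || (y == s x)} ->
  #|A| = (#|f @: A| * 2)%N.
Proof.
move=> sA sN fE; rewrite -sum1_card (partition_big_imset f) /=.
rewrite -sum_nat_const; apply: eq_bigr => _ /imsetP[x xA ->].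
rewrite sum1_card -[RHS](_ : #|[set x; s x]| = 2%N); last first.
  by rewrite cards2 eq_sym sN.
apply: eq_card => y; rewrite !inE; case yA: (y \in A) => /=.
  by rewrite unfold_in /= yA (eq_sym (f y)) fE.
rewrite unfold_in /= yA; apply/esym/negP=> /orP[]/eqP yE; move: yA;
  by rewrite yE ?xA ?sA.
Qed.

(** The map sending [x] to its orbit [{x, s x}] is two-to-one on [A]. *)
Lemma involution_even (T : finType) (s : T -> T) (A : {set T}) :
  {in A, forall x, s x \in A} -> {in A, forall x, s x != x} ->
  {in A, involutive s} -> ~~ odd #|A|.
Proof.
move=> sA sN sK; rewrite (@card_two_to_one _ _ (fun x => [set x; s x]) s A) //.
  by rewrite muln2 odd_double.
move=> x y xA yA; apply/eqP/orP=> [E|[]/eqP->//].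
- have: y \in [set x; s x] by rewrite E set21.
  by rewrite !inE => /orP[]; [left|right].
- by rewrite sK // setUC.
Qed.

(** * Finite local rings in which 2 is invertible *)

Section LocalRing.

Variable R : finComUnitRingType.
Hypothesis unit_local :
  forall x y : R, x + y \is a GRing.unit -> (x \is a GRing.unit) || (y \is a GRing.unit).
Hypothesis unit2 : (2%:R : R) \is a GRing.unit.

Local Notation U := [set x : R | x \is a GRing.unit].
Local Notation M := [set x : R | x \isn't a GRing.unit].

Lemma nonunitD (x y : R) : x \in M -> y \in M -> x + y \in M.
Proof.
by rewrite !inE => xM yM; apply/negP=> /unit_local; rewrite (negPf xM) (negPf yM).
Qed.

Lemma nonunitN (x : R) : (- x \in M) = (x \in M).
Proof. by rewrite !inE unitrN. Qed.

Lemma nonunitB (x y : R) : x \in M -> y \in M -> x - y \in M.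
Proof. by move=> xM yM; rewrite nonunitD ?nonunitN. Qed.

Lemma nonunitMl (x y : R) : x \in M -> y * x \in M.
Proof. by rewrite !inE unitrM negb_and => ->; rewrite orbT. Qed.

Lemma nonunit_sqr (x : R) : (x ^+ 2 \in M) = (x \in M).
Proof. by rewrite !inE unitrX_pos. Qed.

Lemma unitDnonunit (x y : R) : x \is a GRing.unit -> y \in M -> x + y \is a GRing.unit.
Proof.
move=> xU yM; apply: contraLR xU => xyM.
have: (x + y) - y \in M by apply: nonunitB; rewrite // inE.
by rewrite addrK inE.
Qed.

Lemma unit_mul_eq0 (x y : R) : x \is a GRing.unit -> x * y = 0 -> y = 0.
Proof. by move=> xU xy0; rewrite -(mulKr xU y) xy0 mulr0. Qed.

(** * The map [x + a / x] and its fibres *)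

Definition sumset (a : R) : {set R} := [set x + a / x | x in U].

Lemma sum_eq (a x y : R) : x \is a GRing.unit -> y \is a GRing.unit ->
  (x + a / x == y + a / y) = ((x - y) * (x * y - a) == 0).
Proof.
move=> xU yU; rewrite -subr_eq0.
have -> : (x - y) * (x * y - a) = (x * y) * (x + a / x - (y + a / y)).
  rewrite !mulrBr !mulrDr.
  have -> : x * y * (a / x) = y * a * (x / x) by ring.
  have -> : x * y * (a / y) = x * a * (y / y) by ring.
  by rewrite !divrr //; ring.
apply/eqP/eqP => [->|]; first by rewrite mulr0.
by apply: unit_mul_eq0; rewrite unitrM xU.
Qed.

(** These are the units [x] that differ from [a / x] even modulo [M]. *)
Definition regular_points (a : R) : {set R} :=
  [set x in U | x ^+ 2 - a \is a GRing.unit].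

(** If neither [x - y] nor [x * y - a] were a unit, then [x * (x - y) + (x * y - a) = x ^+ 2 - a]
    would lie in [M], against regularity. So one factor is a unit and the other vanishes. *)
Lemma sum_eq_regular (a x y : R) : a \is a GRing.unit ->
  x \in regular_points a -> y \is a GRing.unit ->
  (x + a / x == y + a / y) = (y == x) || (y == a / x).
Proof.
move=> aU; rewrite !inE => /andP[xU rx] yU; rewrite sum_eq //.
have aE : (y == a / x) = (x * y - a == 0).
  by rewrite subr_eq0 -(can_eq (mulKr xU)) mulrCA divrr // mulr1.
rewrite aE (eq_sym y) -(subr_eq0 x y); apply/eqP/orP => [xy0|[]/eqP->]; rewrite ?mul0r ?mulr0 //.
have [dU|dM] := boolP (x - y \is a GRing.unit).
  by right; rewrite (unit_mul_eq0 dU xy0).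
have [eU|eM] := boolP (x * y - a \is a GRing.unit).
  by left; rewrite mulrC in xy0; rewrite (unit_mul_eq0 eU xy0).
have : x * (x - y) + (x * y - a) \in M by rewrite nonunitD ?nonunitMl ?inE.
by rewrite (_ : _ + _ = x ^+ 2 - a) ?inE ?rx //; ring.
Qed.

Lemma regular_points_inv (a x : R) : a \is a GRing.unit ->
  x \in regular_points a -> a / x \in regular_points a.
Proof.
move=> aU; rewrite !inE => /andP[xU rx]; rewrite unitrM aU unitrV xU /=.
have -> : (a / x) ^+ 2 - a = - (a * (x^-1) ^+ 2 * (x ^+ 2 - a)).
  rewrite mulrBr -[a * _ * x ^+ 2]mulrA -exprMn mulVr // expr1n; ring.
by rewrite unitrN !unitrM aU !unitrV xU.
Qed.

Lemma card_sum_regular (a : R) : a \is a GRing.unit ->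
  #|regular_points a| = (#|[set x + a / x | x in regular_points a]%R| * 2)%N.
Proof.
move=> aU; apply: (card_two_to_one (s := fun x => a / x)).
- by move=> x; exact: regular_points_inv.
- move=> x; rewrite !inE => /andP[xU]; apply: contraTneq => xE.
  by rewrite expr2 -{1}xE divrK // subrr unitr0.
- by move=> x y xA yA; apply: sum_eq_regular => //; move: yA; rewrite !inE => /andP[].
Qed.

(** * Squaring on 1 + M and lifting of square roots *)

(** In [(x - y) * (x + y) = 0] the factor [x + y] is 2 modulo [M], hence a unit. *)
Lemma one_add_sqr_inj (x y : R) : x - 1 \in M -> y - 1 \in M ->
  x ^+ 2 = y ^+ 2 -> x = y.
Proof.
move=> xM yM /eqP; rewrite -subr_eq0 subr_sqr mulrC => /eqP xy0.
apply/eqP; rewrite -subr_eq0; apply/eqP; apply: unit_mul_eq0 xy0.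
have -> : x + y = 2%:R + ((x - 1) + (y - 1)) by ring.
by rewrite unitDnonunit // nonunitD.
Qed.

Local Notation M1 := [set x : R | x - 1 \in M].

Lemma card_M1 : #|M1| = #|M|.
Proof.
rewrite -(card_imset M1 (addIr (-1))); congr #|pred_of_set _|.
apply/setP=> x; apply/imsetP/idP=> [[y]|xM]; first by rewrite inE => ? ->.
by exists (x + 1); rewrite ?addrK // inE addrK.
Qed.

Lemma M1_unit (x : R) : x \in M1 -> x \is a GRing.unit.
Proof. by rewrite inE => xM; rewrite -(subrK 1 x) addrC unitDnonunit ?unitr1. Qed.

(* Squaring is injective on 1 + M, hence bijective: this replaces Hensel's lemma. *)
Lemma M1_sqr (x : R) : x \in M1 -> exists2 w, w \in M1 & x = w ^+ 2.
Proof.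
move=> xM; suff E : [set w ^+ 2 | w in M1] = M1.
  by move: xM; rewrite -{1}E => /imsetP[w wM ->]; exists w.
apply/eqP; rewrite eqEcard card_in_imset ?leqnn ?andbT.
  apply/subsetP=> _ /imsetP[w wM ->]; rewrite inE in wM.
  rewrite inE (_ : _ - 1 = (w + 1) * (w - 1)) ?nonunitMl //; ring.
by move=> x1 x2; rewrite !inE => ? ?; apply: one_add_sqr_inj; rewrite inE.
Qed.

(** A square root modulo [M] lifts: [a / c ^+ 2] lies in [1 + M], so it is some [w ^+ 2], and
    [w * c] is a root of [a]. *)
Lemma sqr_lift (a c : R) : a \is a GRing.unit -> a - c ^+ 2 \in M ->
  exists2 b, b \is a GRing.unit & a = b ^+ 2.
Proof.
move=> aU acM; have cU : c \is a GRing.unit.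
  rewrite -(unitrX_pos c (n := 2)) //; have := unitDnonunit aU (y := c ^+ 2 - a).
  by rewrite (addrC a) subrK; apply; rewrite -nonunitN opprB.
have /M1_sqr[w wM wE] : a / c ^+ 2 \in M1.
  rewrite inE (_ : _ - 1 = (c ^+ 2)^-1 * (a - c ^+ 2)) ?nonunitMl //.
  by rewrite mulrBr mulVr ?unitrX // mulrC.
exists (w * c); first by rewrite unitrM M1_unit.
by rewrite exprMn -wE divrK ?unitrX.
Qed.

(** Every unit is regular: if [x ^+ 2 - a] were in [M], then [x] would lift to a square root of
    [a]. *)
Lemma sumset_nonsquare (a : R) : a \is a GRing.unit -> (forall x, x ^+ 2 != a) ->
  #|U| = (#|sumset a| * 2)%N.
Proof.
move=> aU aN; suff E : regular_points a = U.
  by rewrite -{1}E card_sum_regular // E.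
apply/setP=> x; rewrite !inE; case xU: (x \is a GRing.unit) => //=.
apply: contraT => rN; case: (@sqr_lift a x aU) => [|b _ bE].
  by rewrite -nonunitN opprB inE.
by have := aN b; rewrite bE eqxx.
Qed.

(** * The sums coming from 1 + M *)

Definition nonunit_squares : {set R} := [set z ^+ 2 | z in M].

(* With [x = w ^+ 2] one has [x + x^-1 = (w - w^-1) ^+ 2 + 2]. *)
Lemma sum_M1 : [set x + 1 / x | x in M1] = [set z + 2%:R | z in nonunit_squares].
Proof.
have dM w : w \in M1 -> w - w^-1 \in M.
  move=> wM; rewrite (_ : _ - _ = (w + 1) * w^-1 * (w - 1)); last first.
    have -> : (w + 1) * w^-1 * (w - 1) = w * (w / w) - w^-1 by ring.
    by rewrite divrr ?M1_unit // mulr1.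
  by move: wM; rewrite inE => wM; rewrite nonunitMl.
have dE w : w \in M1 -> w ^+ 2 + 1 / w ^+ 2 = (w - w^-1) ^+ 2 + 2%:R.
  move=> /M1_unit wU; rewrite sqrrB divrr // exprVn; ring.
apply/setP=> s; apply/imsetP/imsetP => [[x /M1_sqr[w wM ->] ->]|[_ /imsetP[z zM ->] ->]].
  exists ((w - w^-1) ^+ 2); last exact: dE.
  by apply/imsetP; exists (w - w^-1); rewrite ?dM.
(* Surjectivity of [w - w^-1] from [1 + M] to [M] follows from injectivity, as the two sets have the
   same size. *)
suff /setP/(_ z) : [set w - w^-1 | w in M1] = M.
  rewrite zM => /imsetP[w wM ->]; exists (w ^+ 2); last by rewrite dE.
  move: wM; rewrite !inE => wM.
  by rewrite subr_sqr_1 mulrC unitrM negb_and wM orbT.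
apply/eqP; rewrite eqEcard; apply/andP; split.
  by apply/subsetP=> _ /imsetP[w wM ->]; apply: dM.
rewrite card_in_imset ?card_M1 //.
move=> x y xM yM xyE; have [xU yU] := (M1_unit xM, M1_unit yM).
have : (x * y + 1) * (x - y) = 0.
  have -> : (x * y + 1) * (x - y) = x * y * ((x - x^-1) - (y - y^-1)).
    have -> : x * y * (x - x^-1 - (y - y^-1)) =
      x * y * x - y * (x / x) - x * y * y + x * (y / y) by ring.
    by rewrite !divrr //; ring.
  by rewrite xyE subrr mulr0.
(* It remains to see that [x * y + 1] is a unit: it is 2 modulo [M]. *)
move/unit_mul_eq0 => xy0; apply/eqP; rewrite -subr_eq0 xy0 //.
move: xM yM; rewrite !inE => xM yM.
have -> : x * y + 1 = 2%:R + (y * (x - 1) + (y - 1)) by ring.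
by rewrite unitDnonunit // nonunitD ?nonunitMl // inE.
Qed.

(** * The number of sums when a is a square *)

Lemma sumset_scale (b : R) : b \is a GRing.unit -> #|sumset (b ^+ 2)| = #|sumset 1|.
Proof.
move=> bU; rewrite -(card_imset (sumset 1) (mulrI bU)).
suff -> : sumset (b ^+ 2) = *%R b @: sumset 1 by [].
apply/setP=> s; apply/imsetP/imsetP => [[x]|[_ /imsetP[x + ->] ->]]; rewrite inE => xU.
  move=> ->; exists (b^-1 * x + 1 / (b^-1 * x)).
    by apply/imsetP; exists (b^-1 * x); rewrite // inE unitrM unitrV bU.
  rewrite mulrDr mulVKr // mul1r invrM ?unitrV // invrK; ring.
exists (b * x); first by rewrite inE unitrM bU.
rewrite invrM // mulrDr; congr (_ + _).
have -> : b ^+ 2 * (x^-1 / b) = b * (1 / x) * (b / b) by ring.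
by rewrite divrr // mulr1.
Qed.

Lemma in_oppM1 (x : R) : (x \in [set - x | x in M1]) = (x + 1 \isn't a GRing.unit).
Proof.
apply/imsetP/idP => [[y + ->]|xM].
  by rewrite !inE => ?; rewrite -unitrN opprD opprK.
by exists (- x); rewrite ?opprK // !inE -unitrN opprB opprK addrC.
Qed.

(** A unit is regular for 1 or congruent to 1 or -1 modulo [M], and [x + 1 / x] is an odd function,
    so [-1 + M] gives the negatives of the values on [1 + M]. *)
Lemma sumset1_split :
  sumset 1 = [set x + 1 / x | x in regular_points 1]
    :|: ([set x + 1 / x | x in M1] :|: [set - x | x in [set x + 1 / x | x in M1]]).
Proof.
have E : U = regular_points 1 :|: (M1 :|: [set - x | x in M1]).
  apply/setP=> x; rewrite !inE.
  rewrite in_oppM1.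
  rewrite subr_sqr_1 unitrM.
  have [xU|xM] /= := boolP (x \is a GRing.unit).
    by case: (x - 1 \is a _); case: (x + 1 \is a _).
  by rewrite [x - 1]addrC [x + 1]addrC !unitDnonunit ?inE ?unitrN ?unitr1.
rewrite {1}/sumset E !imsetU -!imset_comp; congr (_ :|: (_ :|: _)).
by apply: eq_imset => x /=; rewrite opprD invrN mulrN.
Qed.

Lemma unit4 : (4%:R : R) \is a GRing.unit.
Proof. by rewrite (natrM R 2 2) unitrM unit2. Qed.

(** The complement of the regular points consists of the classes [M], [1 + M] and [-1 + M], of equal
    size and disjoint because 1 and 2 are units. *)
Lemma card_regular1 : (#|regular_points (1 : R)%R| + 3 * #|M| = #|R|)%N.
Proof.
pose N1 : {set R} := -%R @: M1.
have inN1 x : (x \in N1) = (x + 1 \isn't a GRing.unit) := in_oppM1 x.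
have E : regular_points 1 = ~: (M :|: M1 :|: N1).
  apply/setP=> x; rewrite in_setC !in_setU inN1 !inE.
  by rewrite subr_sqr_1 unitrM !negb_or !negbK andbA.
have d1 : [disjoint M & M1].
  rewrite disjoint_subset; apply/subsetP=> x xM; rewrite [_ \in _]inE /=.
  by apply/negP=> /M1_unit; apply/negP; move: xM; rewrite inE.
have d2 : [disjoint M :|: M1 & N1].
  rewrite disjoint_subset; apply/subsetP=> x; rewrite !in_setU => xM.
  apply/negP; rewrite inN1 => xN; case/orP: xM => xM.
    have : (x + 1) - x \in M by rewrite nonunitB // inE.
    by rewrite addrAC subrr add0r inE unitr1.
  have : (x + 1) - (x - 1) \in M by rewrite nonunitB //; [rewrite inE|move: xM; rewrite inE].
  by rewrite (_ : _ - _ = 2%:R) ?inE ?unit2 //; ring.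
rewrite -[#|R|](cardsC (M :|: M1 :|: N1)) -E addnC; congr addn.
move: d1 d2; rewrite -!leq_card_setU => /eqP d1 /eqP d2.
by rewrite d2 d1 card_imset ?card_M1; [lia | exact: oppr_inj].
Qed.

(** Three disjoint pieces make up the set for 1: [F] from regular points, with
    [2 #|F| + 3 #|M| = #|R|], and [G] and [-G], each as large as [nonunit_squares]. *)
Lemma sumset_square (b : R) : b \is a GRing.unit ->
  (#|sumset (b ^+ 2)%R| * 2 + 3 * #|M| = #|R| + 4 * #|nonunit_squares|)%N.
Proof.
move=> bU; rewrite sumset_scale // sumset1_split.
set A := regular_points 1; set F := [set _ | x in A]; set G := [set _ | x in M1].
have cG : #|G| = #|nonunit_squares|.
  by rewrite /G sum_M1 card_imset //; exact: addIr.
have GM s : s \in G -> s - 2%:R \in M.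
  by rewrite /G sum_M1 => /imsetP[_ /imsetP[z zM ->] ->]; rewrite addrK nonunit_sqr.
(* Modulo [M], [G] lies over 2 and [-G] over -2. [F] avoids both, since
   [x + 1 / x - 2 = (x - 1) ^+ 2 / x], and likewise with plus signs. *)
have FG s : s \in F -> s - 2%:R \notin M /\ s + 2%:R \notin M.
  case/imsetP=> x; rewrite !inE => /andP[xU rx] ->.
  rewrite subr_sqr_1 unitrM in rx; case/andP: rx => r1 r2.
  have -> : x + 1 / x - 2%:R = x^-1 * (x - 1) ^+ 2.
    have -> : x^-1 * (x - 1) ^+ 2 = (x / x) * x - 2%:R * (x / x) + 1 / x by ring.
    by rewrite divrr //; ring.
  have -> : x + 1 / x + 2%:R = x^-1 * (x + 1) ^+ 2.
    have -> : x^-1 * (x + 1) ^+ 2 = (x / x) * x + 2%:R * (x / x) + 1 / x by ring.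
    by rewrite divrr //; ring.
  by rewrite !negbK !unitrM !unitrV xU r1 r2.
have d2 : [disjoint G & -%R @: G].
  rewrite disjoint_subset; apply/subsetP=> s sG; rewrite [_ \in _]inE /=.
  apply/imsetP => -[y yG yE]; have := nonunitD (GM _ sG) (GM _ yG).
  rewrite yE (_ : _ + _ = - 4%:R) ?inE ?unitrN ?unit4 //; ring.
have d1 : [disjoint F & G :|: -%R @: G].
  rewrite disjoint_subset; apply/subsetP=> s /FG[s1 s2]; rewrite [_ \in _]inE /= in_setU.
  apply/norP; split; first by apply: contra s1; exact: GM.
  apply: contra s2 => /imsetP[y /GM yG ->].
  by rewrite -nonunitN opprD opprK.
have := card_regular1; rewrite card_sum_regular ?unitr1 //.
move: d1 d2; rewrite -!leq_card_setU => /eqP -> /eqP ->.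
by rewrite (card_imset _ oppr_inj) cG -/F; lia.
Qed.

(** * The group of unit squares *)

Definition unit_squares : {set R} := [set x ^+ 2 | x in U].

Lemma unit_squares_sqr (x : R) : x \is a GRing.unit -> x ^+ 2 \in unit_squares.
Proof. by move=> xU; apply/imsetP; exists x; rewrite ?inE. Qed.

(** The fibres of squaring are [{x, -x}]: the factors [x - y] and [x + y] add up to the unit
    [2 * x], so one of them is a unit and the other is zero. *)
Lemma card_unit_squares : #|U| = (#|unit_squares| * 2)%N.
Proof.
apply: (card_two_to_one (s := -%R)) => [x|x|x y]; rewrite !inE ?unitrN //.
  move=> xU; rewrite eq_sym -subr_eq0 opprK -mulr2n -mulr_natl.
  by apply: contraTneq xU => /(unit_mul_eq0 unit2)->; rewrite unitr0.
move=> xU yU; rewrite -subr_eq0 subr_sqr (eq_sym y) -(subr_eq0 x y).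
rewrite -(addr_eq0 y x) (addrC y x).
apply/eqP/orP => [xy0|[]/eqP->]; rewrite ?mul0r ?mulr0 //.
have /unit_local/orP[dU|dU] : (x - y) + (x + y) \is a GRing.unit.
- by rewrite (_ : _ + _ = 2%:R * x) ?unitrM ?unit2 //; ring.
- by right; rewrite (unit_mul_eq0 dU xy0).
- by left; rewrite mulrC in xy0; rewrite (unit_mul_eq0 dU xy0).
Qed.

Lemma card_squares :
  #|[set x ^+ 2 | x in [set: R]]| = (#|unit_squares| + #|nonunit_squares|)%N.
Proof.
have -> : [set x ^+ 2 | x in [set: R]] = unit_squares :|: nonunit_squares.
  by rewrite -imsetU (_ : U :|: M = [set: R]) //; apply/setP=> x; rewrite !inE orbN.
apply/eqP; rewrite leq_card_setU disjoint_subset; apply/subsetP=> _ /imsetP[x xU ->].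
rewrite [_ \in _]inE /=; apply/negP=> /imsetP[z]; rewrite -nonunit_sqr => zM E.
by move: zM xU; rewrite -E !inE unitrX_pos // => /negPf->.
Qed.

Lemma unit_squaresM (a b : R) :
  a \in unit_squares -> b \in unit_squares -> a * b \in unit_squares.
Proof.
case/imsetP=> x; rewrite inE => xU -> /imsetP[y]; rewrite inE => yU ->.
by rewrite -exprMn unit_squares_sqr // unitrM xU.
Qed.

Lemma unit_squaresV (a : R) : a \in unit_squares -> a^-1 \in unit_squares.
Proof. by case/imsetP=> x; rewrite inE => xU ->; rewrite -exprVn unit_squares_sqr // unitrV. Qed.

Lemma unit_squaresU (a : R) : a \in unit_squares -> a \is a GRing.unit.
Proof. by case/imsetP=> x; rewrite inE => xU ->; rewrite unitrX. Qed.

(** The unit squares fill half of the units, so their coset by [a] is the other half. Hence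
    [b = a * q] with [q] a square, and [a * b = a ^+ 2 * q]. *)
Lemma nonsquareM (a b : R) : a \is a GRing.unit -> b \is a GRing.unit ->
  a \notin unit_squares -> b \notin unit_squares -> a * b \in unit_squares.
Proof.
move=> aU bU aN bN; pose aQ : {set R} := *%R a @: unit_squares.
have dis : [disjoint unit_squares & aQ].
  rewrite disjoint_subset; apply/subsetP=> s sQ; rewrite [_ \in _]inE /=.
  apply: contra aN => /imsetP[q qQ sE].
  by rewrite -(mulrK (unit_squaresU qQ) a) -sE unit_squaresM ?unit_squaresV.
have E : unit_squares :|: aQ = U.
  apply/eqP; rewrite eqEcard; apply/andP; split.
    apply/subsetP=> s; rewrite !inE => /orP[/unit_squaresU //|/imsetP[q /unit_squaresU qU ->]].
    by rewrite unitrM aU.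
  move: dis; rewrite -leq_card_setU => /eqP ->.
  by rewrite card_unit_squares (card_imset _ (mulrI aU)); lia.
have : b \in U by rewrite inE.
rewrite -E in_setU (negPf bN) /= => /imsetP[q qQ ->].
by rewrite mulrA unit_squaresM // -expr2 unit_squares_sqr.
Qed.

(* If [-1] is a square, negation pairs off the unit squares; otherwise inversion
   pairs off all of them but [1]. *)
Lemma square_opp1 : (-1 \in unit_squares) = ~~ odd #|unit_squares|.
Proof.
have one2 (x : R) : x \is a GRing.unit -> x != - x.
  move=> xU; rewrite -subr_eq0 opprK -mulr2n -mulr_natl.
  by apply: contraTneq xU => /(unit_mul_eq0 unit2)->; rewrite unitr0.
have Q1 : 1 \in unit_squares by rewrite -(expr1n R 2) unit_squares_sqr // unitr1.
case: (boolP (-1 \in unit_squares)) => QN; apply/esym.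
  apply: (@involution_even _ -%R) => [x xQ|x xQ|x _]; last exact: opprK.
    by rewrite -mulN1r unit_squaresM.
  by rewrite eq_sym one2 ?unit_squaresU.
apply/negbTE; rewrite negbK (cardsD1 1) Q1 /=.
apply: (@involution_even _ GRing.inv) => [x|x|x _]; last exact: invrK.
  rewrite !inE => /andP[x1 xQ]; rewrite unit_squaresV // andbT.
  by apply: contra x1 => /eqP E; rewrite -(invrK x) E invr1.
rewrite !inE => /andP[x1 xQ]; apply/eqP => xE.
have xU := unit_squaresU xQ.
(* A fixed point of inversion is 1 or -1: the factors [x + 1] and [1 - x] add up to the unit 2. The
   first is removed, the second is no square. *)
have xx1 : (x - 1) * (x + 1) = 0 by rewrite -subr_sqr_1 expr2 -{2}xE divrr // subrr.
have /unit_local/orP[dU|dU] : (x + 1) + (1 - x) \is a GRing.unit.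
- by rewrite (_ : _ + _ = 2%:R) ?unit2 //; ring.
- rewrite mulrC in xx1; move/eqP: (unit_mul_eq0 dU xx1).
  by rewrite subr_eq0 (negPf x1).
- rewrite -unitrN opprB in dU; move/eqP: (unit_mul_eq0 dU xx1).
  by rewrite addr_eq0 => /eqP xN; rewrite -xN xQ in QN.
Qed.

End LocalRing.

(** * The residue rings of odd prime powers *)

Section PrimePower.

Variables (p : nat) (p_gt2 : (2 < p)%N) (p_prime : prime p).

(** Exponents are written [t.+1] so that the modulus exceeds 1 and ['Z_(p ^ t.+1)] is the true
    residue ring. *)
Lemma pexp_gt1 t : (1 < p ^ t.+1)%N.
Proof. by rewrite -{1}(exp1n t.+1) ltn_exp2r //; lia. Qed.

Lemma Zp_pexp_unit t (x : 'Z_(p ^ t.+1)) : (x \is a GRing.unit) = ~~ (p %| x)%N.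
Proof. by rewrite -{1}(natr_Zp x) unitZpE ?pexp_gt1 // coprime_pexpl // prime_coprime. Qed.

Lemma Zp_nat_unit t m : ((m%:R : 'Z_(p ^ t.+1)) \is a GRing.unit) = ~~ (p %| m)%N.
Proof. by rewrite unitZpE ?pexp_gt1 // coprime_pexpl // prime_coprime. Qed.

Lemma Zp_pexp_local t (x y : 'Z_(p ^ t.+1)) : x + y \is a GRing.unit ->
  (x \is a GRing.unit) || (y \is a GRing.unit).
Proof.
rewrite -(natr_Zp x) -(natr_Zp y) -natrD !Zp_nat_unit -negb_and; apply: contra.
by case/andP; exact: dvdn_add.
Qed.

Lemma Zp_pexp_unit2 t : (2%:R : 'Z_(p ^ t.+1)) \is a GRing.unit.
Proof. by rewrite Zp_nat_unit gtnNdvd. Qed.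

Lemma card_Zp_pexp t : #|'Z_(p ^ t.+1)| = (p ^ t.+1)%N.
Proof. by rewrite card_ord Zp_cast ?pexp_gt1. Qed.

Lemma card_units_pexp t :
  #|[set x : 'Z_(p ^ t.+1) | x \is a GRing.unit]| = (p.-1 * p ^ t)%N.
Proof.
rewrite -(totient_pfactor p_prime (ltn0Sn t)) totient_count_coprime.
rewrite -[X in index_iota _ X](Zp_cast (pexp_gt1 t)) big_mkord.
rewrite -sum1_card; under eq_bigl do rewrite inE.
rewrite big_mkcond /=.
by apply: eq_bigr => x _; rewrite -{1}(natr_Zp x) unitZpE ?pexp_gt1 //; case: coprime.
Qed.

Lemma card_nonunits_pexp t :
  #|[set x : 'Z_(p ^ t.+1) | x \isn't a GRing.unit]| = (p ^ t)%N.
Proof.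
have := cardsC [set x : 'Z_(p ^ t.+1) | x \is a GRing.unit].
rewrite card_units_pexp card_Zp_pexp => E.
transitivity #|~: [set x : 'Z_(p ^ t.+1) | x \is a GRing.unit]|.
  by apply: eq_card => x; rewrite !inE.
apply/eqP; rewrite -(eqn_add2l (p.-1 * p ^ t)) E expnS -{1}(prednK (prime_gt0 p_prime)).
by rewrite mulSn addnC.
Qed.

Lemma natr_Zp_eq n k m : (1 < n)%N -> (k%:R == m%:R :> 'Z_n) = (k == m %[mod n])%N.
Proof. by move=> n1; rewrite -val_eqE /= !val_Zp_nat. Qed.

Lemma intr_Zp_eq0 n (k : int) : (1 < n)%N -> (k%:~R == 0 :> 'Z_n) = (n%:Z %| k)%Z.
Proof.
move=> n1; rewrite dvdzE absz_nat.
have E m : ((m%:R : 'Z_n) == 0) = (n %| m)%N.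
  by rewrite (natr_Zp_eq m 0 n1) mod0n.
by case: k => m; rewrite ?NegzE ?rmorphN ?oppr_eq0 ?abszN /= -?pmulrn E.
Qed.

Lemma intr_Zp_eq n (k m : int) : (1 < n)%N ->
  (k%:~R == m%:~R :> 'Z_n) = (k == m %[mod n%:Z])%Z.
Proof. by move=> n1; rewrite eqz_mod_dvd -subr_eq0 -rmorphB intr_Zp_eq0. Qed.

(** * The number of squares of nonunits *)

(* Multiplication by [p ^ 2] identifies [Z/p^t] with the ideal [p^2 Z/p^(t+2)]. *)
Lemma nonunit_squares_step t :
  #|nonunit_squares 'Z_(p ^ t.+3)| = #|[set x ^+ 2 | x in [set: 'Z_(p ^ t.+1)]]|.
Proof.
have n1 := pexp_gt1 t; have n3 := pexp_gt1 t.+2.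
have nE : (p ^ t.+3 = p ^ 2 * p ^ t.+1)%N by rewrite -expnD.
have p2 : (0 < p ^ 2)%N by rewrite expn_gt0; lia.
pose h (x : 'Z_(p ^ t.+1)) : 'Z_(p ^ t.+3) := (p ^ 2 * x)%N%:R.
(* [h] does not depend on the representative: changing [k] by a multiple of [p ^ t.+1] changes
   [p ^ 2 * k] by a multiple of [p ^ t.+3]. *)
have hnat k : h k%:R = (p ^ 2 * k)%N%:R.
  by apply/eqP; rewrite natr_Zp_eq // val_Zp_nat // nE -!muln_modr modn_mod.
have h_inj : injective h.
  move=> x y /eqP; rewrite natr_Zp_eq // nE -!muln_modr eqn_pmul2l //.
  by rewrite -natr_Zp_eq // !natr_Zp => /eqP.
rewrite -(card_imset _ h_inj); congr #|pred_of_set _|.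
apply/setP=> s; apply/imsetP/imsetP => [[z]|[_ /imsetP[z _ ->] ->]].
  rewrite inE Zp_pexp_unit negbK => /dvdnP[k zE] ->.
  exists (k%:R ^+ 2); first by apply/imsetP; exists k%:R.
  by rewrite -natrX hnat -(natr_Zp z) zE -natrX mulnC expnMn.
exists ((p * z)%N%:R); first by rewrite inE Zp_nat_unit dvdn_mulr.
by rewrite -{1}(natr_Zp z) -!natrX hnat expnMn.
Qed.

Lemma card_nonunit_squares0 : #|nonunit_squares 'Z_(p ^ 1)| = 1%N.
Proof.
rewrite /nonunit_squares; have /eqP/cards1P[x ->] := card_nonunits_pexp 0.
by rewrite imset_set1 cards1.
Qed.

Lemma card_nonunit_squares1 : #|nonunit_squares 'Z_(p ^ 2)| = 1%N.
Proof.
apply/eqP/cards1P; exists 0; apply/setP=> s; rewrite !inE.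
apply/imsetP/eqP => [[z]|->]; last by exists 0; rewrite ?inE ?unitr0 ?expr0n.
rewrite inE Zp_pexp_unit negbK => /dvdnP[k zE] ->.
apply/eqP; rewrite -(natr_Zp z) zE -natrX (natr_Zp_eq _ 0) ?pexp_gt1 //.
by rewrite mod0n expnMn -/(dvdn _ _) dvdn_mull.
Qed.

Lemma card_nonunit_squaresSS t :
  (#|nonunit_squares 'Z_(p ^ t.+3)| * 2 =
   p.-1 * p ^ t + #|nonunit_squares 'Z_(p ^ t.+1)| * 2)%N.
Proof.
rewrite nonunit_squares_step card_squares mulnDl; congr addn.
by rewrite -card_units_pexp (card_unit_squares (@Zp_pexp_local t) (Zp_pexp_unit2 t)).
Qed.

(** The right side is what remains of [A_count p t.+1] after its first term [(p - 3) p^t / 2]. *)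
Lemma card_nonunit_squares t :
  #|nonunit_squares 'Z_(p ^ t.+1)|%:R * 2 =
    p%:R ^+ t / (p%:R + 1) + 3 / 2 + (-1) ^+ t * (p%:R - 1) / (2 * (p%:R + 1)) :> rat.
Proof.
have p1 : (p%:R + 1 : rat) != 0 by rewrite natr1 pnatr_eq0.
have: forall t, (#|nonunit_squares 'Z_(p ^ t.+3)|%:R * 2 =
   (p%:R - 1) * p%:R ^+ t + #|nonunit_squares 'Z_(p ^ t.+1)|%:R * 2 :> rat).
  move=> k; rewrite -!natrM card_nonunit_squaresSS natrD !natrM natrX.
  by rewrite -subn1 natrB //; lia.
move=> step.
(* The recursion reaches back two steps, so the induction covers all [k] up to [t], with base cases
   0 and 1. *)
suff: forall k, (k <= t)%N -> #|nonunit_squares 'Z_(p ^ k.+1)|%:R * 2 =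
    p%:R ^+ k / (p%:R + 1) + 3 / 2 + (-1) ^+ k * (p%:R - 1) / (2 * (p%:R + 1)) :> rat by apply.
elim: t => [|t IH] [|[|k]] kt //.
- by rewrite card_nonunit_squares0; field.
- by rewrite card_nonunit_squares0; field.
- by rewrite card_nonunit_squares1; field.
rewrite step IH; last by lia.
by rewrite !exprS; field.
Qed.

(** * Translation of the definitions into the residue ring *)

Lemma Zp_pexp_int_unit t (a : int) :
  ((a%:~R : 'Z_(p ^ t.+1)) \is a GRing.unit) = ~~ (p%:Z %| a)%Z.
Proof.
rewrite dvdzE absz_nat -(Zp_nat_unit t).
by case: a => m; rewrite ?NegzE ?rmorphN ?unitrN ?abszN /= -?pmulrn.
Qed.

(** As [a] is a unit modulo [p ^ t.+1], both coordinates of a solution are units and the first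
    determines the second. *)
Lemma H2_units t (a : int) : ~~ (p%:Z %| a)%Z ->
  [set ((u.1 : nat)%:R, (u.2 : nat)%:R) | u : 'I_(p ^ t.+1) * 'I_(p ^ t.+1) in H2 a (p ^ t.+1)] =
  [set (x, a%:~R / x) | x in [set x : 'Z_(p ^ t.+1) | x \is a GRing.unit]].
Proof.
move=> pNa; have n1 := pexp_gt1 t; have := pNa; rewrite -(Zp_pexp_int_unit t) => aU.
apply/setP=> s; apply/imsetP/imsetP => [[u]|[x]]; rewrite inE.
  case/and3P=> _ _; rewrite -intr_Zp_eq // -pmulrn natrM => /eqP aE ->.
  move: (aU); rewrite -aE unitrM => /andP[xU yU].
  by exists (u.1 : nat)%:R; rewrite ?inE // [in _ / _]mulrC mulKr.
move=> xU ->; have [y yE] : {y | y = a%:~R / x} by exists (a%:~R / x).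
have yU : y \is a GRing.unit by rewrite yE unitrM aU unitrV.
have lt (z : 'Z_(p ^ t.+1)) : (z < p ^ t.+1)%N.
  by rewrite -[X in (_ < X)%N](Zp_cast n1) ltn_ord.
(* The lower bounds in [H2] hold because a unit is not the residue 0. *)
have gt0 (z : 'Z_(p ^ t.+1)) : z \is a GRing.unit -> (0 < z)%N.
  by rewrite Zp_pexp_unit; case: (nat_of_ord z) => //; rewrite dvdn0.
rewrite -yE; exists (Ordinal (lt x), Ordinal (lt y)); last first.
  by congr (_, _); rewrite -[LHS]natr_Zp.
rewrite inE [_.1]/= [_.2]/=.
rewrite [nat_of_ord (Ordinal (lt x))]/= [nat_of_ord (Ordinal (lt y))]/=.
rewrite !gt0 //= -intr_Zp_eq // -pmulrn natrM !natr_Zp.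
by rewrite yE mulrC divrK.
Qed.

Lemma S2bar_sumset t (a : int) : ~~ (p%:Z %| a)%Z ->
  S2bar a (p ^ t.+1) = sumset (a%:~R : 'Z_(p ^ t.+1)).
Proof.
pose n := (p ^ t.+1)%N; move=> /(H2_units t).
move=> /(congr1 (fun X : {set 'Z_n * 'Z_n} => [set v.1 + v.2 | v in X])).
by rewrite -!imset_comp.
Qed.

Lemma D2bar_sumset t (a : int) : ~~ (p%:Z %| a)%Z ->
  D2bar a (p ^ t.+1) = sumset (- a%:~R : 'Z_(p ^ t.+1)).
Proof.
pose n := (p ^ t.+1)%N; move=> /(H2_units t).
move=> /(congr1 (fun X : {set 'Z_n * 'Z_n} => [set v.1 - v.2 | v in X])).
rewrite -!imset_comp => E; rewrite /D2bar [LHS]E.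
by apply: eq_imset => x; rewrite /= mulNr.
Qed.

(** The symbol sees only squares modulo [p]; [sqr_lift] carries a root modulo [p] up to [p ^ t.+1],
    and reduction carries one back. *)
Lemma legendre_square t (a : int) : ~~ (p%:Z %| a)%Z ->
  legendre a p = if a%:~R \in unit_squares 'Z_(p ^ t.+1) then 1 else -1.
Proof.
move=> pNa; rewrite /legendre (negPf pNa); congr (if _ then _ else _).
have := pNa; rewrite -(Zp_pexp_int_unit t) => aU.
apply/existsP/imsetP => [[x]|[z _ zE]].
  rewrite eq_sym eqz_mod_dvd => xE.
  have [|b bU ->] := @sqr_lift _ (@Zp_pexp_local t) (Zp_pexp_unit2 t) _ x%:R aU.
    by rewrite inE -natrX pmulrn -rmorphB Zp_pexp_int_unit negbK.
  by exists b; rewrite ?inE.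
have p0 : (0 < p)%N by lia.
exists (Ordinal (ltn_pmod z p0)) => /=.
rewrite modz_nat modnXm -modz_nat.
have : ((z ^ 2)%N%:Z == a %[mod (p ^ t.+1)%N%:Z])%Z.
  by rewrite -intr_Zp_eq ?pexp_gt1 // -pmulrn natrX natr_Zp zE.
by rewrite !eqz_mod_dvd; apply: dvdz_trans; rewrite dvdzE !absz_nat expnS dvdn_mulr.
Qed.

(** There are [p./2 * p ^ t] unit squares, with [p ^ t] odd, so the parity is that of [p./2]. *)
Lemma square_opp1_pexp t : (-1 \in unit_squares 'Z_(p ^ t.+1)) = (p %% 4 == 1)%N.
Proof.
rewrite (square_opp1 (@Zp_pexp_local t) (Zp_pexp_unit2 t)).
have := card_unit_squares (@Zp_pexp_local t) (Zp_pexp_unit2 t).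
rewrite card_units_pexp; set q := #|_| => E.
have podd : odd p by case: (even_prime p_prime) => // p2; move: p_gt2; rewrite p2.
have pt : odd (p ^ t) by rewrite oddX podd orbT.
have : q = (p./2 * p ^ t)%N.
  have pE : p.-1 = (p./2 * 2)%N by have := odd_double_half p; rewrite podd; lia.
  by move: E; rewrite pE; lia.
by move=> ->; rewrite oddM pt andbT; have := odd_double_half p; rewrite podd; lia.
Qed.

(** * Cardinalities for squares and nonsquares *)

Lemma card_sumset_square t (a : 'Z_(p ^ t.+1)) : a \in unit_squares 'Z_(p ^ t.+1) ->
  #|sumset a|%:R = A_count p t.+1 :> rat.
Proof.
case/imsetP=> b; rewrite inE => bU ->.
have := sumset_square (@Zp_pexp_local t) (Zp_pexp_unit2 t) bU.
rewrite card_nonunits_pexp card_Zp_pexp => /(congr1 (fun n => n%:R : rat)).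
rewrite [(_ * 2 + _)%N%:R]natrD [(_ + 4 * _)%N%:R]natrD [(_ * 2)%N%:R]natrM.
rewrite [(3 * _)%N%:R]natrM [(4 * _)%N%:R]natrM !natrX => E.
have := card_nonunit_squares t; rewrite /A_count /= => Q.
have p1 : (p%:R + 1 : rat) != 0 by rewrite natr1 pnatr_eq0.
move: E Q; set s := #|sumset _|%:R; set q := #|_|%:R => E Q.
have -> : s = (p%:R * p%:R ^+ t + 2 * (q * 2) - 3 * p%:R ^+ t) / 2.
  apply: (mulIf (_ : 2 != 0 :> rat)) => //; rewrite divfK //; apply: (addIr (3 * p%:R ^+ t)).
  by rewrite E exprS; ring.
by rewrite Q; field.
Qed.

Lemma card_sumset_nonsquare t (a : 'Z_(p ^ t.+1)) : a \is a GRing.unit ->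
  a \notin unit_squares 'Z_(p ^ t.+1) ->
  #|sumset a|%:R = (totient (p ^ t.+1))%:R / 2 :> rat.
Proof.
move=> aU aN; rewrite totient_pfactor //= -card_units_pexp.
rewrite (sumset_nonsquare (@Zp_pexp_local t) (Zp_pexp_unit2 t) aU).
  by rewrite natrM mulfK.
move=> x; apply: contra aN => /eqP xE; rewrite -xE unit_squares_sqr //.
by rewrite -(unitrX_pos x (n := 2)) // xE.
Qed.

End PrimePower.

Theorem theorem3p6 (p t : nat) (a : int)
    (p_gt2 : (2 < p)%N) (p_prime : prime p) (t_ge1 : (1 <= t)%N)
    (pNa : ~~ (p%:Z %| a)%Z) :
  [/\ legendre a p = 1 ->
        #|S2bar a (p ^ t)|%:R = A_count p t :> rat,
      legendre a p = -1 ->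
        #|S2bar a (p ^ t)|%:R = (totient (p ^ t))%:R / 2%:R :> rat,
      (p = 1 %[mod 4])%N /\ legendre a p = 1 \/
      (p = 3 %[mod 4])%N /\ legendre a p = -1 ->
        #|D2bar a (p ^ t)|%:R = A_count p t :> rat
    & (p = 1 %[mod 4])%N /\ legendre a p = -1 \/
      (p = 3 %[mod 4])%N /\ legendre a p = 1 ->
        #|D2bar a (p ^ t)|%:R = (totient (p ^ t))%:R / 2%:R :> rat].
Proof.
case: t t_ge1 => // t _; rewrite S2bar_sumset // D2bar_sumset //.
rewrite (legendre_square p_gt2 p_prime t pNa).
have := square_opp1_pexp p_gt2 p_prime t.
have := pNa; rewrite -(Zp_pexp_int_unit p_gt2 p_prime t); set b := a%:~R => bU.
set Q := unit_squares _ => Q1.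
(* The differences are the sums for [-b], so their number depends on whether [-1 * b] is a square,
   which the class of [p] modulo 4 and the symbol of [a] decide. *)
have bN : - b = -1 * b by rewrite mulN1r.
have loc := @Zp_pexp_local p p_gt2 p_prime t; have u2 := Zp_pexp_unit2 p_gt2 p_prime t.
have N1U : (-1 : 'Z_(p ^ t.+1)) \is a GRing.unit by rewrite unitrN unitr1.
have QM x y : x \in Q -> y \in Q -> x * y \in Q by apply: unit_squaresM.
have NQ x y : x \is a GRing.unit -> x \in Q -> x * y \in Q -> y \in Q.
  by move=> xU xQ xyQ; rewrite -(mulKr xU y) QM // unit_squaresV.
case: (boolP (b \in Q)) => bQ; split => //.
- by move=> _; apply: card_sumset_square.
- case=> [[p1 _]|[]//]; apply: card_sumset_square => //.
  by rewrite bN QM // Q1; apply/eqP.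
- case=> [[_ //]|[p3 _]]; apply: card_sumset_nonsquare; rewrite ?unitrN //.
  apply/negP; rewrite bN mulrC => /(NQ _ _ bU bQ); rewrite Q1; lia.
- by move=> _; apply: card_sumset_nonsquare.
- case=> [[_ //]|[p3 _]]; apply: card_sumset_square => //.
  (* Here -1 and [b] are both nonsquares, so their product is a square. *)
  by rewrite bN nonsquareM // Q1; lia.
- case=> [[p1 _]|[]//]; apply: card_sumset_nonsquare; rewrite ?unitrN //.
  apply/negP; rewrite bN => /(NQ _ _ N1U); rewrite Q1 (negPf bQ); lia.
Qed.
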